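(* Let $\Gamma<{\bf O}(n,1)$ be of the form $\Gamma=\Sigma\rtimes[\delta_1,\dots,\delta_m]$ or $\Gamma=\Sigma\times[\delta_1,\dots,\delta_m]$, where $\Sigma<\Gamma$ is a subgroup such that the ring $\mathcal{I}(\Sigma)$ is finitely generated and $\delta_1,\dots,\delta_m\in\Gamma$, $m\ge1$, are involutions ($\delta_i^2=I$). The following algorithm computes generators of $\mathcal{I}(\Gamma)$. Input: a set $\{u_1,\dots,u_s\}$ of generators of the ring $\mathcal{I}(\Sigma)$, and the set of involutions $\delta_i$, $i=1,\dots,m$. Output: generators of $\mathcal{I}(\Gamma)$. Procedure: Set $\Sigma_0:=\Sigma$, $u_{0i}:=u_i$ for $i=1,\dots,s$, and $s_0:=s$. For $k$ from $1$ to $m$ do: (1) set $\Sigma_k:=\Sigma_{k-1}\rtimes{\bf Z}_2(\delta_k)$; (2) take the operators $R(f)(x)=f(x)+f(\delta x)$ and $S(f)(x)=f(x)-f(\delta x)$ with $\delta:=\delta_k$; (3) from $\{u_{k-1,j}: j=1,\dots,s_{k-1}\}$ compute the set $\{R(u_{k-1,i}),\ S(u_{k-1,i})\,S(u_{k-1,j}) : 1\le i,j\le s_{k-1}\}$; (4) return generators of $\mathcal{I}(\Sigma_k)$: $\{u_{k1},\dots,u_{ks_k}\}$. After the loop, return generators of $\mathcal{I}(\Gamma)$: $\{u_{m1},\dots,u_{ms_m}\}$.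
   Context: Here $n\ge1$, and Minkowski space $\mathbb{R}^{n+1}_1$ is $\mathbb{R}^{n+1}$ with the pseudo inner product $\langle x,y\rangle=x^tJy$, where $J=\mathrm{diag}(1,\dots,1,-1)$ ($n$ ones) and $t$ denotes transposition. The Lorentz group ${\bf O}(n,1)=\{A\in GL(n+1,\mathbb{R}):A^tJA=J\}$ and its subgroups act on $\mathbb{R}^{n+1}_1$ by matrix multiplication. For a subgroup $G<{\bf O}(n,1)$, $\mathcal{I}(G)$ denotes the ring of $G$-invariant functions $f:\mathbb{R}^{n+1}_1\to\mathbb{R}$, i.e. those with $f(\gamma x)=f(x)$ for all $\gamma\in G$ and all $x$. A set $\{u_1,\dots,u_s\}$ of invariant functions is a set of generators of the ring if every invariant $f$ can be written as $f(x)=h(u_1(x),\dots,u_s(x))$ for some $h:\mathbb{R}^s\to\mathbb{R}$. $[\delta_1,\dots,\delta_m]$ denotes the group generated by $\delta_1,\dots,\delta_m$, and ${\bf Z}_2(\delta)=\{I,\delta\}$ is the group generated by an involution $\delta$. The symbols $\rtimes$ and $\times$ denote semidirect and direct product.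
   Formalization: The formal theorem adds the assumption that each δ_k normalizes Σ_{k-1}, so that the product Σ_{k-1}⋊Z_2(δ_k) in step (1) is defined; without it the claim fails, e.g. for Σ trivial and two reflections generating the dihedral group of order 6. *)

(* Defs.v *)
From HB Require Import structures.
From mathcomp Require Import all_boot all_order all_algebra.
From mathcomp Require Import classical_sets reals.

Set Implicit Arguments.
Unset Strict Implicit.
Unset Printing Implicit Defensive.

Import Order.TTheory GRing.Theory Num.Theory.

Local Open Scope classical_set_scope.
Local Open Scope ring_scope.

Section MatrixGroups.
Variables (R : realType) (n : nat).
Local Notation M := 'M[R]_n.+1.
Implicit Types (A B d : M) (G H K : set M).

Definition lorentz_mx : M :=
  diag_mx (\row_(i < n.+1) if i == ord_max then -1 else 1).

Definition lorentz_group : set M :=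
  [set A | A \in unitmx /\ A^T *m lorentz_mx *m A = lorentz_mx].

(* Subgroups of GL(n+1, R), as (possibly infinite) sets of matrices *)
Definition mx_group H : Prop :=
  [/\ forall A, H A -> A \in unitmx,
      H 1,
      forall A B, H A -> H B -> H (A * B)
    & forall A, H A -> H A^-1].

Definition mx_generated (D : set M) : set M := smallest mx_group D.

Definition normalizes B H : Prop := [set B * A * B^-1 | A in H] = H.

Definition mx_setprod H K : set M := [set A * B | A in H & B in K].

(* Internal semidirect product G = H ><| K, with H the normal factor *)
Definition semidirect G H K : Prop :=
  [/\ [/\ mx_group G, mx_group H & mx_group K],
      H `<=` G /\ K `<=` G,
      forall B, G B -> normalizes B H,
      H `&` K = [set 1]
    & mx_setprod H K = G].

(* Internal direct product: both factors are normal *)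
Definition direct G H K : Prop :=
  semidirect G H K /\ forall B, G B -> normalizes B K.

Definition involution d : Prop := d ^+ 2 = 1.

Definition Z2 d : set M := [set 1; d].

(* The group Sigma_k: successive products of Sigma with Z_2(delta_1), ...,
   Z_2(delta_k). The product Sigma_(k-1) Z_2(delta_k) is a group as soon as
   delta_k normalizes Sigma_(k-1), and it is the semidirect product of its
   factors when moreover delta_k does not belong to Sigma_(k-1). *)
Definition alg_group (Sigma : set M) (delta : seq M) (k : nat) : set M :=
  foldl (fun H d => mx_setprod H (Z2 d)) Sigma (take k delta).

End MatrixGroups.

Section Invariants.
Variables (R : realType) (n : nat).
Local Notation M := 'M[R]_n.+1.
Local Notation V := 'cV[R]_n.+1.
Implicit Types (d : M) (G : set M) (f : V -> R) (u : seq (V -> R)).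

(* The carrier of the ring I(G) *)
Definition invariants G : set (V -> R) :=
  [set f | forall g, G g -> forall x, f (g *m x) = f x].

(* The family u generates I(G) in the functional sense: the function h below
   is arbitrary, not necessarily a polynomial. *)
Definition generators G u : Prop :=
  (forall i : 'I_(size u), invariants G (tnth (in_tuple u) i)) /\
  (forall f, invariants G f ->
     exists h : 'rV[R]_(size u) -> R,
       forall x, f x = h (\row_(i < size u) tnth (in_tuple u) i x)).

Definition finitely_generated G : Prop := exists u, generators G u.

Definition Rop d f : V -> R := fun x => f x + f (d *m x).
Definition Sop d f : V -> R := fun x => f x - f (d *m x).

Definition alg_step d u : seq (V -> R) :=
  [seq Rop d f | f <- u] ++
  [seq (fun x => Sop d f x * Sop d g x) | f <- u, g <- u].

(* The family u_(k,1), ..., u_(k,s_k) after k passes through the loop *)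
Definition alg_gens u (delta : seq M) (k : nat) : seq (V -> R) :=
  foldl (fun v d => alg_step d v) u (take k delta).

End Invariants.

(* Main.v *)
(** A family generates I(G), with an arbitrary outer function h, exactly when its
    members are G-invariant and every G-invariant function takes equal values at
    points that the family does not separate.  Let d be an involution normalizing
    H.  If all R(u_i) and all S(u_i)S(u_j) agree at x and y, then the vectors
    S(u)(x) and S(u)(y) are equal up to one common sign, and together with
    R(u)(x) = R(u)(y) this means u(x) = u(y) or u(x) = u(d y); hence every
    function invariant under H and d agrees at x and y.  Finally the last group
    of the loop contains Sigma and all delta_i, so it is Gamma. *)

Require Import Defs.
From HB Require Import structures.
From mathcomp Require Import all_boot all_order all_algebra.
From mathcomp Require Import classical_sets reals.
From mathcomp Require Import boolp ring lra.

Set Implicit Arguments.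
Unset Strict Implicit.
Unset Printing Implicit Defensive.

Import Order.TTheory GRing.Theory Num.Theory.

Local Open Scope classical_set_scope.
Local Open Scope ring_scope.

Section Groups.
Variables (R : realType) (n : nat).
Local Notation M := 'M[R]_n.+1.
Implicit Types (A B d : M) (G H K : set M).

Lemma involution_unitmx d : involution d -> d \in unitmx.
Proof. by rewrite /involution expr2 => dd; apply: (mulmx1_unit dd).1. Qed.

Lemma involution_inv d : involution d -> d^-1 = d.
Proof.
move=> dd; have du : d \is a GRing.unit := involution_unitmx dd.
by apply: (mulrI du); rewrite divrr // involution_mulr.
Qed.

Lemma involution_mulr d : involution d -> d * d = 1.
Proof. by rewrite /involution expr2. Qed.

Lemma normalizes_conj B H A : normalizes B H -> H A -> H (B * A * B^-1).
Proof. by move=> nBH HA; rewrite -nBH; exists A. Qed.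

(** This is the commutation rule used below to move [d] to the right past an element of [H]. *)
Lemma normalizes_involutionE d H A :
  involution d -> normalizes d H -> H A -> exists2 A', H A' & d * A = A' * d.
Proof.
move=> dd ndH HA; exists (d * A * d^-1); first exact: normalizes_conj.
by rewrite mulrVK //; exact: involution_unitmx.
Qed.

Lemma mx_group_Z2 d : involution d -> mx_group (Z2 d).
Proof.
move=> dd; split.
- by move=> A [] ->; [exact: unitmx1 | exact: involution_unitmx].
- by left.
- move=> A B [] -> [] ->; rewrite ?mul1r ?mulr1; by [left | right].
- by move=> A [] ->; [left; rewrite /= invr1 | right; rewrite /= involution_inv].
Qed.

Lemma setprod_Z2P H d B :
  mx_setprod H (Z2 d) B <-> H B \/ exists2 A, H A & B = A * d.
Proof.
split=> [[A HA [C [] ->] <-]|[HB|[A HA ->]]].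
- by left; rewrite mulr1.
- by right; exists A.
- by exists B => //; exists 1; [left | rewrite mulr1].
- by exists A => //; exists d; [right|].
Qed.

Lemma sub_setprodl H d : H `<=` mx_setprod H (Z2 d).
Proof. by move=> A HA; apply/setprod_Z2P; left. Qed.

Lemma setprod_Z2_gen H d : H 1 -> mx_setprod H (Z2 d) d.
Proof. by move=> H1; apply/setprod_Z2P; right; exists 1; rewrite ?mul1r. Qed.

(** Every element is [A] or [A * d] with [A] in [H]. Moving [d] to the right past [H] and cancelling
    [d * d] brings products and inverses back to this form, also when [d] lies in [H]. *)
Lemma mx_group_setprod_Z2 H d : mx_group H -> involution d -> normalizes d H ->
  mx_group (mx_setprod H (Z2 d)).
Proof.
move=> [Hu H1 HM HV] dd ndH; have dV := involution_inv dd.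
split.
- move=> B /setprod_Z2P[/Hu //|[A HA ->]].
  by rewrite unitmx_mul Hu //= involution_unitmx.
- exact: sub_setprodl.
- move=> B C /setprod_Z2P[HB|[A HA ->]] /setprod_Z2P[HC|[A' HA' ->]];
    apply/setprod_Z2P.
  + by left; apply: HM.
  + by right; exists (B * A'); [exact: HM | rewrite mulrA].
  + have [C' HC' e] := normalizes_involutionE dd ndH HC.
    by right; exists (A * C'); [exact: HM | rewrite -!mulrA e].
  + have [C' HC' e] := normalizes_involutionE dd ndH HA'.
    left; rewrite -mulrA (mulrA d) e -mulrA involution_mulr // mulr1; exact: HM.
- move=> B /setprod_Z2P[HB|[A HA ->]]; apply/setprod_Z2P; first by left; apply: HV.
  have [A' HA' e] := normalizes_involutionE dd ndH (HV _ HA).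
  right; exists A' => //; rewrite -e invrM ?dV //; first exact: Hu.
  exact: involution_unitmx.
Qed.

(** Since [normalizes] is an equality of sets, stability under conjugation by [B] gives one
    inclusion only; conjugation by the inverse supplies the other. *)
Lemma normalizes_two_sided H B : B \in unitmx -> (forall A, H A -> H (B * A * B^-1)) ->
  (forall A, H A -> H (B^-1 * A * B)) -> normalizes B H.
Proof.
move=> Bu nB nBV; apply/seteqP; split=> [_ [A HA <-]|A HA]; first exact: nB.
exists (B^-1 * A * B); first exact: nBV.
have Bu' : B \is a GRing.unit := Bu.
by rewrite !mulrA divrr // mul1r -mulrA divrr // mulr1.
Qed.

Lemma semidirect_setprod_Z2 H d : mx_group H -> involution d ->
  normalizes d H -> ~ H d -> semidirect (mx_setprod H (Z2 d)) H (Z2 d).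
Proof.
move=> gH dd ndH Hd; have gG := mx_group_setprod_Z2 gH dd ndH.
have gK := mx_group_Z2 dd; have [Hu H1 HM HV] := gH.
have dV := involution_inv dd.
have conj B A : mx_setprod H (Z2 d) B -> H A -> H (B * A * B^-1).
  move=> /setprod_Z2P[HB|[C HC ->]] HA; first by apply: (HM); [exact: HM|exact: HV].
  rewrite invrM ?dV; [|exact: Hu|exact: involution_unitmx].
  (* Conjugation by [C * d] is conjugation by [d], under which [H] is stable, followed by
     conjugation by an element of [H]. *)
  have := normalizes_conj ndH HA; rewrite dV => HdA.
  have -> : C * d * A * (d * C^-1) = C * (d * A * d) * C^-1 by rewrite !mulrA.
  by apply: (HM); [exact: HM|exact: HV].
split=> //.
- split; first exact: sub_setprodl.
  by move=> _ [] ->; [exact: sub_setprodl | exact: setprod_Z2_gen].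
- move=> B GB; have [Gu _ _ GV] := gG.
  apply: normalizes_two_sided => // [|A|A HA]; [exact: Gu | exact: conj |].
  by rewrite -{2}(invrK B); apply: conj => //; apply: GV.
(* Here [~ H d] enters: it makes the intersection trivial. *)
- apply/seteqP; split=> [A [HA [//|Ad]]|_ ->]; last by split; [|left].
  by move: HA; rewrite Ad.
Qed.

(** Entries of [s] are counted from 0, so the pass from group [k] to group [k.+1] uses entry [k]. *)
Lemma alg_groupS (Sigma : set M) (s : seq M) k d0 : (k < size s)%N ->
  alg_group Sigma s k.+1 = mx_setprod (alg_group Sigma s k) (Z2 (nth d0 s k)).
Proof. by move=> ks; rewrite /alg_group (take_nth d0) // foldl_rcons. Qed.

End Groups.

Section Invariants.
Variables (R : realType) (n : nat).
Local Notation M := 'M[R]_n.+1.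
Local Notation V := 'cV[R]_n.+1.
Implicit Types (d : M) (G H : set M) (f : V -> R) (u : seq (V -> R)).

Lemma generatorsP G u : generators G u <->
  (forall f, f \in u -> invariants G f) /\
  (forall f, invariants G f ->
     forall x y, (forall g, g \in u -> g x = g y) -> f x = f y).
Proof.
split=> [[uG ug]|[uG ug]]; split.
- by move=> f /(tnthP (in_tuple u))[i ->]; apply: uG.
- move=> f /ug[h fh] x y uxy; rewrite !fh; congr h; apply/rowP => i.
  by rewrite !mxE; apply: uxy; apply: mem_tnth.
- by move=> i; apply: uG; apply: mem_tnth.
move=> f fG; pose U x : 'rV[R]_(size u) :=
  \row_(i < size u) tnth (in_tuple u) i x.
(* The outer function evaluates [f] at a chosen point of the fibre of [U] over [r]. The default 0 is
   taken only when [r] is outside the image of [U]. *)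
exists (fun r => f (xget 0 [set x | U x = r])) => x.
have := xgetPex 0 (ex_intro (fun y => U y = U x) x erefl).
set y := xget _ _ => /= Uyx; apply: ug => // _ /(tnthP (in_tuple u))[i ->].
by have /rowP/(_ i) := Uyx; rewrite !mxE.
Qed.

Lemma alg_gensS u (s : seq M) k d0 : (k < size s)%N ->
  alg_gens u s k.+1 = alg_step (nth d0 s k) (alg_gens u s k).
Proof. by move=> ks; rewrite /alg_gens (take_nth d0) // foldl_rcons. Qed.

Lemma mem_alg_step d u f : reflect
  ((exists2 g, g \in u & f = Rop d g) \/
   exists g h, [/\ g \in u, h \in u & f = fun x => Sop d g x * Sop d h x])
  (f \in alg_step d u).
Proof.
rewrite mem_cat; apply: (iffP orP).
  case=> [/mapP[g gu ->]|/allpairsP[[g h] [gu hu ->]]]; first by left; exists g.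
  by right; exists g, h.
case=> [[g gu ->]|[g [h [gu hu ->]]]]; [left; exact: map_f | right].
by apply/allpairsP; exists (g, h).
Qed.

Lemma invariants_setprod_Z2 H d f : H 1 ->
  invariants (mx_setprod H (Z2 d)) f <->
  invariants H f /\ forall x, f (d *m x) = f x.
Proof.
move=> H1; split=> [fG|[fH fd] B /setprod_Z2P[/fH //|[A HA ->] x]].
  split=> [A HA|]; first by apply: fG; apply: sub_setprodl.
  by apply: fG; apply: setprod_Z2_gen.
by rewrite -mulmxA fH.
Qed.

Lemma involution_mulmxK d (x : V) : involution d -> d *m (d *m x) = x.
Proof. by rewrite /involution expr2 mulmxA -mulmxE => ->; rewrite mul1mx. Qed.

Lemma invariants_comp H d f : involution d -> normalizes d H ->
  invariants H f -> invariants H (fun x => f (d *m x)).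
Proof.
move=> dd ndH fH A HA x; have [A' HA' e] := normalizes_involutionE dd ndH HA.
by rewrite mulmxA mulmxE e -mulmxE -mulmxA fH.
Qed.

Lemma generators_alg_step H d u : mx_group H -> involution d ->
  normalizes d H -> generators H u ->
  generators (mx_setprod H (Z2 d)) (alg_step d u).
Proof.
move=> [_ H1 _ _] dd ndH /generatorsP[uH ug]; apply/generatorsP; split.
  move=> f fu; apply/invariants_setprod_Z2 => //.
  move: fu => /mem_alg_step [[g gu ->]|[g [h [gu hu ->]]]];
    split; rewrite /Rop /Sop.
  - by move=> A HA x; rewrite (invariants_comp dd ndH (uH g gu) HA) (uH g gu A HA).
  - by move=> x; rewrite involution_mulmxK // addrC.
  - move=> A HA x; rewrite (uH g gu A HA) (uH h hu A HA).
    by rewrite (invariants_comp dd ndH (uH g gu) HA) (invariants_comp dd ndH (uH h hu) HA).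
  - by move=> x; rewrite !involution_mulmxK //; ring.
move=> f /invariants_setprod_Z2-/(_ H1)[fH fd] x y xy.
have Rxy g : g \in u -> g x + g (d *m x) = g y + g (d *m y).
  by move=> gu; apply: (xy (Rop d g)); apply/mem_alg_step; left; exists g.
have Sxy g h : g \in u -> h \in u ->
    Sop d g x * Sop d h x = Sop d g y * Sop d h y.
  move=> gu hu; apply: (xy (fun z => Sop d g z * Sop d h z)).
  by apply/mem_alg_step; right; exists g, h.
have [[g gu Sg]|Su0] := pselect (exists2 g, g \in u & Sop d g x != 0); last first.
  apply: ug => // h hu; have Sx : Sop d h x = 0.
    by apply/eqP/negPn/negP => Shx; apply: Su0; exists h.
  (* The diagonal product shows that the square of [Sop d h y] is 0; with equal values of [Rop d h]
     this gives [h x = h y]. *)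
  have /esym/eqP := Sxy _ _ hu hu; rewrite Sx mul0r mulf_eq0 orbb => /eqP.
  by move: Sx (Rxy _ hu); rewrite /Sop; lra.
(* the sign is read off a single g with S(g)(x) != 0 *)
have : (Sop d g x == Sop d g y) || (Sop d g x == - Sop d g y).
  by rewrite -eqf_sqr !expr2 Sxy.
case/orP=> /eqP e.
  apply: ug => // h hu; have : Sop d h x = Sop d h y.
    by apply: (mulfI Sg); rewrite Sxy // -e.
  by move: (Rxy _ hu); rewrite /Sop; lra.
(* With the sign -1, [x] is compared with [d *m y]: passing from [y] to [d *m y] keeps [Rop d h] and
   negates [Sop d h]. *)
rewrite -(fd y); apply: ug => // h hu; have : Sop d h x = - Sop d h y.
  by apply: (mulfI Sg); rewrite Sxy // e mulrNN.
by move: (Rxy _ hu); rewrite /Sop; lra.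
Qed.

End Invariants.

Theorem mainTheorem2 (R : realType) (n : nat) (hn : (1 <= n)%N)
    (Gamma Sigma : set 'M[R]_n.+1)
    (hGamma : mx_group Gamma) (hGammaO : Gamma `<=` @lorentz_group R n)
    (hSigma : mx_group Sigma) (hSigmaG : Sigma `<=` Gamma)
    (hfg : finitely_generated Sigma)
    (m : nat) (hm : (1 <= m)%N) (delta : m.-tuple 'M[R]_n.+1)
    (hdeltaG : forall i : 'I_m, Gamma (tnth delta i))
    (hdelta : forall i : 'I_m, involution (tnth delta i))
    (hprod :
      semidirect Gamma Sigma
        (mx_generated [set d | exists i : 'I_m, d = tnth delta i]) \/
      direct Gamma Sigma
        (mx_generated [set d | exists i : 'I_m, d = tnth delta i]))
    (* the semidirect products formed in the loop are defined *)
    (hstep : forall k : 'I_m,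
      normalizes (tnth delta k) (alg_group Sigma delta k))
    (u : seq ('cV[R]_n.+1 -> R)) (hu : generators Sigma u) :
  [/\ forall k : 'I_m, ~ alg_group Sigma delta k (tnth delta k) ->
        semidirect (alg_group Sigma delta k.+1)
          (alg_group Sigma delta k) (Z2 (tnth delta k)),
      forall k : nat, (1 <= k <= m)%N ->
        generators (alg_group Sigma delta k) (alg_gens u delta k)
    & generators Gamma (alg_gens u delta m)].
Proof.
have dE (k : 'I_m) : nth 0 delta k = tnth delta k by rewrite (tnth_nth 0).
have SS (k : 'I_m) : alg_group Sigma delta k.+1 =
    mx_setprod (alg_group Sigma delta k) (Z2 (tnth delta k)).
  by rewrite (alg_groupS _ 0) ?size_tuple ?dE.
(* The normalization hypothesis at each pass propagates the group property through the loop, whether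
   or not the new involution already lies in the current group. *)
have grp k : (k <= m)%N -> mx_group (alg_group Sigma delta k).
  elim: k => [|k IH] km; first by rewrite /alg_group take0.
  rewrite (SS (Ordinal km)); apply: mx_group_setprod_Z2; first exact/IH/ltnW.
    exact: hdelta.
  exact: (hstep (Ordinal km)).
have gens k : (k <= m)%N ->
    generators (alg_group Sigma delta k) (alg_gens u delta k).
  elim: k => [|k IH] km; first by rewrite /alg_group /alg_gens take0.
  rewrite (SS (Ordinal km)) (alg_gensS _ 0) ?size_tuple // (dE (Ordinal km)).
  apply: generators_alg_step; [exact/grp/ltnW | exact: hdelta | | exact/IH/ltnW].
  exact: (hstep (Ordinal km)).
split=> [k kd|k /andP[_ km]|]; last 2 first.
- exact: gens.
- rewrite (_ : Gamma = alg_group Sigma delta m); first exact: gens.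
  have mono j k : (j + k <= m)%N ->
      alg_group Sigma delta j `<=` alg_group Sigma delta (j + k)%N.
    elim: k => [|k IH] km; first by rewrite addn0.
    rewrite addnS in km *; rewrite (SS (Ordinal km)).
    by apply: (subset_trans (IH (ltnW km))); apply: sub_setprodl.
  have subm j : (j <= m)%N ->
      alg_group Sigma delta j `<=` alg_group Sigma delta m.
    by move=> jm; have := mono j (m - j)%N; rewrite subnKC //; apply.
  apply/seteqP; split; last first.
    (* The last group lies in [Gamma], because each pass only multiplies elements of [Gamma]. *)
    have [_ _ GM _] := hGamma.
    suff sub k : (k <= m)%N -> alg_group Sigma delta k `<=` Gamma by apply: sub.
    elim: k => [|k IH] km; first by rewrite /alg_group take0.
    rewrite (SS (Ordinal km)) => B /setprod_Z2P[|[A HA ->]]; first exact/IH/ltnW.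
    by apply: GM; [exact: (IH (ltnW km)) | exact: hdeltaG].
  (* For the converse, both cases of [hprod] write [Gamma] as the product of [Sigma] and the group
     generated by the involutions, so it is enough to place each factor in the last group. *)
  have [_ _ _ _ <-] : semidirect Gamma Sigma
      (mx_generated [set d | exists i : 'I_m, d = tnth delta i]).
    by case: hprod => // -[].
  have [_ _ mM _] := grp m (leqnn m).
  move=> _ [A SA [B DB <-]]; apply: mM.
    by apply: (subm 0) => //; rewrite /alg_group take0.
  (* [B] lies in every group containing all the involutions; the last group is one of them, since
     involution [i] enters at stage [i.+1] and the stages increase. *)
  apply: DB; split; first exact: grp.
  move=> _ [i ->]; apply: (subm i.+1) => //; rewrite SS.
  by apply: setprod_Z2_gen; have [] := grp i (ltnW (ltn_ord i)).
- rewrite SS; apply: semidirect_setprod_Z2 => //; exact/grp/ltnW.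
Qed.
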